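(* For every 2-connected chordal graph $G$, $\mathrm{lct}(G)\leq\max\{1,\omega(G)-3\}$.
   Context: A graph is chordal if every induced cycle has length three. $\omega(G)$ is the cardinality of a maximum clique of $G$. $\mathrm{lct}(G)$ is the minimum cardinality of a set of vertices that intersects every longest cycle (cycle of maximum length) of $G$. *)

(* Defs.v *)
(* A finite simple graph is a symmetric irreflexive
   relation e : rel T on a finite type T of vertices. *)
From mathcomp Require Import all_boot.
Set Implicit Arguments. Unset Strict Implicit. Unset Printing Implicit Defensive.

Section Graphs.
Variables (T : finType) (e : rel T).

Definition is_cycle (c : seq T) : Prop :=
  [/\ uniq c, 3 <= size c & cycle e c].

Definition induced_cycle (c : seq T) : Prop :=
  is_cycle c /\
  {in c &, forall x y, e x y -> (y == next c x) || (x == next c y)}.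

Definition chordal : Prop :=
  forall c, induced_cycle c -> size c = 3.

Definition induced_rel (A : {set T}) : rel T :=
  [rel x y | [&& x \in A, y \in A & e x y]].

Definition connected_on (A : {set T}) : Prop :=
  {in A &, forall x y, connect (induced_rel A) x y}.

Definition two_connected : Prop :=
  [/\ 3 <= #|T|, connected_on setT &
      forall v : T, connected_on (setT :\ v)].

Definition clique (S : {set T}) : bool :=
  [forall x in S, forall y in S, (x != y) ==> e x y].

Definition omega : nat := \max_(S : {set T} | clique S) #|S|.

Definition longest_cycle (c : seq T) : Prop :=
  is_cycle c /\ forall c', is_cycle c' -> size c' <= size c.

Definition hits_longest_cycles (S : {set T}) : Prop :=
  forall c, longest_cycle c -> has (fun x => x \in S) c.

Definition is_lct (n : nat) : Prop :=
  (exists S : {set T}, hits_longest_cycles S /\ #|S| = n) /\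
  (forall S : {set T}, hits_longest_cycles S -> n <= #|S|).

End Graphs.

(* Main.v *)
(** Suppose no small set meets every longest cycle, and let [K] be a maximal
    clique. Deleting three vertices of [K] leaves a set of size [#|K| - 3], so
    for every triple of [K] some longest cycle meets [K] only inside it. Let [p]
    be a longest path with both ends [a], [b] in [K] and interior outside [K],
    and [H] the component of [G - K] containing that interior. By chordality
    some [c] in [K] has no neighbour in [H]. If a longest cycle meets [K] inside
    a triple [{a, c, d}] and uses [c], then swapping [p] for one of its arcs
    makes it longer. So it meets [K] exactly in [a] and [d]; the same swap shows
    that both its arcs meet [p], hence it lies in [H] apart from [a] and [d]. The
    same holds for [b] and [d], so at least two pairs of [K] are cut out by
    longest cycles living in [H] (cycles meeting [K] at most once also live in
    a component, and play the same role).

    Take such [K] and [H] with [H] smallest. A vertex [v] of [H] dominates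
    [N(H)]; let [K'] be a maximal clique containing [N(H)] and [v]. Its
    component [H'] is either strictly inside [H], against minimality, or disjoint
    from [H], and then two longest cycles, one on each side, can be chosen with
    at most one common vertex. This is impossible in a 2-connected graph. *)
Require Import Defs.
From mathcomp Require Import all_boot zify.
From Stdlib Require Import Classical.
Set Implicit Arguments. Unset Strict Implicit. Unset Printing Implicit Defensive.

Section Graph.
Variables (T : finType) (e : rel T).
Hypotheses (e_sym : symmetric e) (e_irr : irreflexive e).

(** * Walks, paths and connectivity *)

Lemma first_hit (Z : pred T) x q : path e x q -> Z (last x q) ->
  exists q', [/\ path e x q', Z (last x q'),
    forall y, y \in belast x q' -> ~~ Z y & {subset x :: q' <= x :: q}].
Proof.
elim: q x => [|y q IH] x /=; first by move=> _ Zx; exists [::]; split.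
case/andP=> exy pq Zl; have [Zx|NZx] := boolP (Z x).
  by exists [::]; split=> // z; rewrite !inE => ->.
have [q' [pq' Zq' Nq' sq']] := IH _ pq Zl.
exists (y :: q'); split=> //=; first by rewrite exy.
  by move=> z; rewrite inE => /predU1P[->|/Nq'].
move=> z; rewrite inE => /predU1P[->|/sq' zq]; first exact: mem_head.
by rewrite inE zq orbT.
Qed.

Lemma last_exit (A : pred T) x q : path e x q -> has A (x :: q) ->
  exists y q', [/\ path e y q', A y, last y q' = last x q,
    forall z, z \in q' -> ~~ A z & {subset y :: q' <= x :: q}].
Proof.
elim: q x => [|y q IH] x; first by rewrite /= orbF => _ Ax; exists x, [::]; split.
move=> pq; have [hA _|/hasPn NA] := boolP (has A (y :: q)); last first.
  rewrite -cat1s has_cat has_seq1 => /orP[Ax|/hasP[z zq Az]].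
    by exists x, (y :: q); split.
  by have:= NA z zq; rewrite Az.
have /andP[_ pq'] := pq.
have [y' [q' [? ? ? ? s']]] := IH y pq' hA.
by exists y', q'; split=> // z /s'; rewrite [in X in _ -> X]in_cons => ->; rewrite orbT.
Qed.

(** Stop the walk at its first vertex in [B], restart it at its last vertex in [A], then remove
    repetitions. Each stage only discards vertices, so what the earlier stages achieved survives. *)
Lemma clean_path (A B : pred T) x q : path e x q -> A x -> B (last x q) ->
  exists x' q', [/\ path e x' q', uniq (x' :: q'), A x', B (last x' q')
   & [/\ {subset x' :: q' <= x :: q}, forall z, z \in x' :: q' -> A z -> z = x'
     & forall z, z \in x' :: q' -> B z -> z = last x' q']].
Proof.
move=> pq Ax Bl.
have [q1 [p1 B1 N1 s1]] := first_hit pq Bl.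
have hA : has A (x :: q1) by rewrite /= Ax.
have [y [q2 [p2 Ay l2 N2 s2]]] := last_exit p1 hA.
exists y; case/shortenP: p2 l2 => q3 p3 u3 s3 l3.
have s3' : {subset y :: q3 <= y :: q2}.
  by move=> z; rewrite !inE => /orP[->//|/s3 ->]; rewrite orbT.
exists q3; rewrite l3; split=> //; split.
- by move=> z /s3' /s2 /s1.
- move=> z; rewrite inE => /predU1P[//|/s3 /N2 /negP NA] Az; by case: NA.
- move=> z /s3' /s2; rewrite lastI mem_rcons inE => /predU1P[//|/N1 /negP NB] Bz.
  by case: NB.
Qed.

Lemma path_suffix x q z : path e x q -> z \in x :: q ->
  exists q', [/\ path e z q', last z q' = last x q & {subset z :: q' <= x :: q}].
Proof.
move=> pq zq; have hz: has (pred1 z) (x :: q) by apply/hasP; exists z => //=.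
by have [y [q' [? /eqP yz ? _ ?]]] := last_exit pq hz; subst y; exists q'; split.
Qed.

Lemma connect_path (A : {set T}) x y : x \in A -> connect (induced_rel e A) x y ->
  exists q, [/\ path e x q, last x q = y & {subset x :: q <= A}].
Proof.
move=> xA /connectP[q pq ->]; exists q; split=> //.
  by apply: sub_path pq => u v /and3P[].
elim: q x xA pq => [|z q IH] x xA /=; first by move=> _ y'; rewrite inE => /eqP->.
case/andP=> /and3P[_ zA _] pq y'; rewrite inE => /predU1P[->//|]; exact: IH pq _.
Qed.

Lemma induced_path_connect (A : {set T}) x q : path e x q -> {subset x :: q <= A} ->
  forall y, y \in x :: q -> connect (induced_rel e A) x y.
Proof.
move=> pq sq y yq; apply: (@path_connect _ _ x q) yq.
elim: q x pq sq => [//|z q IH] x /= /andP[exz pq] sq.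
apply/andP; split; last by apply: IH => // t tq; apply: sq; rewrite inE tq orbT.
by apply/and3P; split=> //; apply: sq; rewrite !inE eqxx ?orbT.
Qed.

Lemma induced_connect_sym (A : {set T}) : symmetric (connect (induced_rel e A)).
Proof.
apply: sym_connect_sym => s t; rewrite /induced_rel /= e_sym.
by case: (s \in _) (t \in _) => [] [].
Qed.

Lemma path_rev x q : path e (last x q) (rev (belast x q)) = path e x q.
Proof. by rewrite rev_path; apply: eq_path => u v; rewrite e_sym. Qed.

(* Shortening a walk along a chord or a repetition keeps it non-trivial, so
   the shortest one closes up to an induced cycle. *)
Lemma chordal_common_neighbour (Q : {set T}) x u s : chordal e -> e x u ->
  x \notin Q -> u \notin Q -> path e x (rcons s u) -> {subset s <= Q} ->
  s != [::] -> exists z, [/\ z \in Q, e x z & e z u].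
Proof.
move=> che exu xQ uQ.
have [n] := ubnP (size s); elim: n s => // n IH s sn ps sQ s0.
have [s1|s1] := leqP (size s) 1.
  case: s {IH sn} s0 s1 ps sQ => [|z [|//]] //= _ _ /and3P[exz ezu _] sQ.
  by exists z; rewrite sQ ?mem_head.
set c := x :: rcons s u.
have szc : size c = (size s).+2 by rewrite /= size_rcons.
have c0 : nth x c 0 = x by [].
have cl : nth x c (size s).+1 = u by rewrite /= nth_rcons ltnn eqxx.
have cQ i : 0 < i < (size s).+1 -> nth x c i \in Q.
  case: i => // i; rewrite /= ltnS => /= ilt.
  by rewrite nth_rcons ilt sQ ?mem_nth.
have edge i : i <= size s -> e (nth x c i) (nth x c i.+1).
  by move=> il; move/pathP: ps => /(_ x i); rewrite size_rcons ltnS => /(_ il).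
(* A chord between positions [i] and [k] of [c] lets the walk skip everything between them. The
   excluded pair is the edge [x u] itself, whose shortcut would leave nothing inside [Q]. *)
have cut i k : i.+1 < k -> k <= (size s).+1 -> (i == 0) && (k == (size s).+1) = false ->
    e (nth x c i) (nth x c k) -> exists z, [/\ z \in Q, e x z & e z u].
  case: k => // k ik kl ne eik; rewrite eqSS in ne; rewrite !ltnS in ik kl.
  have rk : drop k (rcons s u) = rcons (drop k s) u by rewrite drop_rcons.
  have sz : size (take i s ++ drop k s) = i + (size s - k).
    by rewrite size_cat size_drop size_takel //; lia.
  apply: (IH (take i s ++ drop k s)).
  - by rewrite sz; lia.
  - rewrite rcons_cat cat_path -rk; apply/andP; split.
      by move: ps; rewrite -{1}(cat_take_drop i s) rcons_cat cat_path => /andP[].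
    have -> : last x (take i s) = nth x c i.
      have il : i <= size s by lia.
      rewrite -nth_last size_takel //; case: i il {ik ne eik sz} => [|i] il.
        by rewrite take0.
      by rewrite nth_take //= nth_rcons il.
    rewrite (drop_nth x) ?size_rcons ?ltnS //=.
    have -> : e (nth x c i) (nth x (rcons s u) k) by [].
    move: ps; rewrite -{1}(cat_take_drop k (rcons s u)) cat_path => /andP[_].
    by rewrite (drop_nth x) ?size_rcons ?ltnS //= => /andP[].
  - by move=> z; rewrite mem_cat => /orP[/mem_take|/mem_drop] /sQ.
  - by rewrite -size_eq0 sz; lia.
have [//|Nz] := classic (exists z, [/\ z \in Q, e x z & e z u]).
(* A repetition at inner positions [i < j] makes position [i] adjacent to position [j.+1], which is
   again a shortcut. The ends differ from the rest because they are adjacent and outside [Q]. *)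
have inj i j : i < j -> j <= (size s).+1 -> nth x c i <> nth x c j.
  move=> ij jl eij; apply: Nz.
  have [i0|i0] := posnP i.
    move: eij; rewrite i0 c0 => xj; have [js|js] := ltnP j (size s).+1.
      by have /negP[] := xQ; rewrite xj cQ //; lia.
    have jE : j = (size s).+1 by lia.
    by move: exu; rewrite xj jE cl e_irr.
  have [js|js] := ltnP j (size s).+1; last first.
    have jE : j = (size s).+1 by lia.
    by have /negP[] := uQ; rewrite -cl -jE -eij cQ //; lia.
  by apply: (@cut i j.+1) => //; [lia | rewrite eij edge].
have uc : uniq c.
  apply/(uniqP x) => i j; rewrite !inE szc !ltnS => il jl eij.
  by case: (ltngtP i j) => // lt; [case: (inj i j) | case: (inj j i)].
have nxt i : i <= size s -> next c (nth x c i) = nth x c i.+1.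
  by move=> il; rewrite next_nth mem_nth ?szc 1?ltnW // index_uniq // szc ltnW.
have: induced_cycle e c.
  split; first by split=> //; [rewrite szc; lia | rewrite /= rcons_path ps last_rcons e_sym].
  have main i j : i < j -> j <= (size s).+1 -> e (nth x c i) (nth x c j) ->
      (nth x c j == next c (nth x c i)) || (nth x c i == next c (nth x c j)).
    move=> ij jl eij; have [jE|jE] := eqVneq j i.+1.
      by rewrite jE nxt ?eqxx //; lia.
    case ne : ((i == 0) && (j == (size s).+1)); last by case: Nz; apply: (@cut i j) => //; lia.
    case/andP: ne => /eqP -> /eqP ->; rewrite cl c0.
    have uin : u \in c by rewrite inE mem_rcons mem_head orbT.
    rewrite [next c u]next_nth uin.
    have -> : index u c = (size s).+1 by rewrite -cl index_uniq // szc.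
    (* [next] looks up the tail of [c] with its head as default, so the out-of-range index of [u]
       wraps around to [x]. *)
    by rewrite /c nth_default ?eqxx ?orbT // size_rcons.
  move=> y z /(nthP x)[i il <-] /(nthP x)[j jl <-] eij.
  rewrite szc !ltnS in il jl; case: (ltngtP i j) => lt; first exact: main.
    by rewrite orbC; apply: main; rewrite // e_sym.
  by rewrite lt e_irr in eij.
by move/che; rewrite szc; lia.
Qed.

Lemma path_suffix_behead x q z : path e x q -> z \in q ->
  exists q', [/\ path e z q', last z q' = last x q & {subset z :: q' <= q}].
Proof. by case: q => // y q /andP[_ pq] zq; exact: path_suffix pq zq. Qed.

(** * Components of the complement of a clique *)

Definition component (K : {set T}) z := [set y | connect (induced_rel e (~: K)) z y].

Definition attachment (H K : {set T}) := [set x in K | [exists h in H, e x h]].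

Section Component.
Variables (K : {set T}) (z : T).
Hypothesis zK : z \notin K.
Let H := component K z.

Lemma component_id : z \in H.
Proof. by rewrite inE. Qed.

Lemma component_notin y : y \in H -> y \notin K.
Proof.
rewrite inE => zy; have [|q [_ <- sq]] := connect_path _ zy; first by rewrite inE.
by have /setCP/negP := sq _ (mem_last z q).
Qed.

Lemma component_step y y' : y \in H -> y' \notin K -> e y y' -> y' \in H.
Proof.
move=> yH y'K eyy'; have yK := component_notin yH; move: yH; rewrite !inE => zy.
by apply: connect_trans zy (connect1 _); apply/and3P; rewrite !inE.
Qed.

Lemma component_path y q : y \in H -> path e y q -> {in q, forall t, t \notin K} ->
  {subset q <= H}.
Proof.
elim: q y => [//|t q IH] y yH /= /andP[eyt pq] qK.
have tH : t \in H by apply: component_step eyt; rewrite ?qK ?mem_head.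
move=> s; rewrite inE => /predU1P[->//|]; apply: IH pq _ _ => // r rq.
by apply: qK; rewrite inE rq orbT.
Qed.

Lemma component_connect y y' : y \in H -> y' \in H ->
  exists q, [/\ path e y q, last y q = y' & {subset y :: q <= H}].
Proof.
move=> yH y'H; have yK := component_notin yH.
have /connect_path [|q [pq lq sq]] : connect (induced_rel e (~: K)) y y'.
- move: yH y'H; rewrite !inE => zy zy'; apply: connect_trans zy'.
  by rewrite induced_connect_sym.
- by rewrite inE.
exists q; split=> // t; rewrite inE => /predU1P[->//|]; apply: component_path pq _ _ => //.
by move=> r rq; have := sq r; rewrite !inE rq orbT => /(_ isT).
Qed.

Lemma component_neighbour y y' : y \in H -> e y y' -> y' \in H :|: attachment H K.
Proof.
move=> yH eyy'; rewrite in_setU [y' \in attachment _ _]inE.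
have [y'K|y'K] := boolP (y' \in K); last by rewrite (component_step yH).
by rewrite orbC; apply/orP; left; apply/existsP; exists y; rewrite yH e_sym.
Qed.

(** Let [v] in [H] see as much of the attachment as possible, and suppose it misses [u]. Walk inside
    [H] from [v] to the first neighbour of [u]. For [x] seen by [v], the walk closes up through the
    edge [x u], so chordality gives a vertex of the walk adjacent to both [x] and [u]. Only the end
    of the walk is adjacent to [u]; hence that end sees all that [v] sees, and [u] as well. *)
Lemma component_dominating : chordal e -> clique e K ->
  exists2 v, v \in H & {in attachment H K, forall x, e v x}.
Proof.
move=> che /forall_inP clK.
set N := fun v => [set x in attachment H K | e v x].
case: (@arg_maxnP _ z (mem H) (fun v => #|N v|) component_id) => v vH vmax.
exists v => // u uX; have [//|Nvu] := boolP (e v u).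
have uK : u \in K by move: uX; rewrite inE => /andP[].
have [w wH ewu] : exists2 w, w \in H & e w u.
  by move: uX; rewrite inE => /andP[_ /exists_inP[w wH]]; rewrite e_sym; exists w.
have [q [pq lq sq]] := component_connect vH wH.
have hit : [pred y | e y u] (last v q) by rewrite lq.
have [q' [pq' Zq' Nq' sq']] := first_hit pq hit.
have qH : {subset v :: q' <= H} by move=> t /sq' /sq.
have sN : N v \subset N (last v q').
  apply/subsetP => x; rewrite !inE => /andP[/andP[xK xH] evx].
  rewrite xK xH /= e_sym.
  have exu : e x u.
    have /forall_inP/(_ u uK)/implyP := clK x xK; apply; apply: contraNneq Nvu => <-.
    exact: evx.
  have nin y : y \in K -> y \notin [set t in v :: q'].
    by move=> yK; rewrite inE; apply/negP => /qH /component_notin; rewrite yK.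
  have [||||] := @chordal_common_neighbour [set t in v :: q'] x u (v :: q') che exu _ _ _ _ isT.
  - exact: nin.
  - exact: nin.
  - by rewrite /= e_sym evx rcons_path pq'.
  - by move=> t tq; rewrite in_set.
  move=> t [tq ext etu]; move: tq; rewrite in_set lastI mem_rcons inE.
  by case/predU1P=> [<-//|/Nq']; rewrite /= etu.
have uN : u \in N (last v q') by rewrite inE uX.
have: N v \proper N (last v q').
  by apply/properP; split=> //; exists u => //; rewrite inE (negPf Nvu) andbF.
move/proper_card; rewrite ltnNge => /negP[]; apply: vmax.
exact: (qH _ (mem_last v q')).
Qed.

End Component.

(** * Longest cycles of a 2-connected graph meet twice *)

Definition linked (B : pred T) w w' := exists p p',
  [/\ path e w p, path e w' p', B (last w p), B (last w' p')
    & forall t, t \in w :: p -> t \notin w' :: p'].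

Section Linked.
Hypothesis conn_minus : forall v, connected_on e (setT :\ v).

(** Walk from [w2], avoiding [w1], until one of the two given walks is met. If it is the one from
    [w], follow it into [B] while [w1] keeps its own. If it is the one from [w1], follow that one,
    and let [w1] step back to [w] and use the other. *)
Lemma linked_step B w w1 w2 : e w w1 -> e w1 w2 -> linked B w w1 -> linked B w1 w2.
Proof.
move=> e1 e2 [p [p0 [pp pp1 Bp Bp1 dis]]].
case/shortenP: pp1 Bp1 dis => p1 pp1 up1 sp1 Bp1 dis0.
have dis t : t \in w :: p -> t \notin w1 :: p1.
  move=> /dis0; apply: contra; rewrite !inE => /orP[->//|/sp1 ->]; by rewrite orbT.
have ww1 : w != w1 by have:= dis w (mem_head _ _); rewrite inE negb_or => /andP[].
have w21 : w2 != w1 by apply: contraTneq e2 => ->; rewrite e_irr.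
have w2in : w2 \in setT :\ w1 by rewrite !inE w21.
have win : w \in setT :\ w1 by rewrite !inE ww1.
have [q [pq lq sq]] := connect_path w2in (conn_minus w2in win).
have hit : [pred t | (t \in w :: p) || (t \in p1)] (last w2 q).
  by rewrite lq /= mem_head.
have [q' [pq' /= Zq' Nq' sq']] := first_hit pq hit.
have q'1 t : t \in w2 :: q' -> t != w1 by move=> /sq' /sq; rewrite !inE andbT.
have zq t : t \in w2 :: q' -> (t == last w2 q') || ~~ [|| t == w, t \in p | t \in p1].
  rewrite lastI mem_rcons inE => /predU1P[->|/Nq']; first by rewrite eqxx.
  by rewrite inE orbA => ->; rewrite orbT.
case/orP: Zq' => z_in.
  have [s [ps ls ss]] := path_suffix pp z_in.
  exists p1, (q' ++ s); split=> //.
  - by rewrite cat_path pq'.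
  - by rewrite last_cat ls.
  move=> t tp1; rewrite -cat_cons mem_cat negb_or; apply/andP; split; last first.
    apply: contraL tp1 => ts; apply: dis; apply: ss; by rewrite inE ts orbT.
  apply: contraL tp1 => tq; have /orP[/eqP ->|] := zq t tq; first exact: dis.
  by rewrite !inE !negb_or q'1 //= => /and3P[].
have [s [ps ls ss]] := path_suffix_behead pp1 z_in.
exists (w :: p), (q' ++ s); split=> //.
- by rewrite /= e_sym e1.
- by rewrite cat_path pq'.
- by rewrite last_cat ls.
move=> t tp1; rewrite -cat_cons mem_cat negb_or.
have Nt : t \notin p1.
  move: tp1; rewrite in_cons => /predU1P[->|/dis]; first by case/andP: up1.
  by rewrite inE negb_or => /andP[].
apply/andP; split; last by apply: contra Nt => ts; apply: ss; rewrite inE ts orbT.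
apply: contraL tp1 => tq; have /orP[/eqP tz|] := zq t tq.
  by rewrite tz z_in in Nt.
by rewrite !inE !negb_or q'1 //= => /and3P[-> ->].
Qed.

(** The instance of Menger's theorem required here. An edge at [b] is linked, since [b] already lies
    in [B] and its other end reaches [b'] without [b]; [linked_step] then carries the property edge
    by edge from [b] to [w]. *)
Lemma linked_edge (B : pred T) b b' w w' : connected_on e setT -> B b -> B b' ->
  b != b' -> e w w' -> linked B w w'.
Proof.
move=> conn Bb Bb' bb'.
have [q [pq <- _]] := connect_path (in_setT b) (conn _ _ (in_setT b) (in_setT w)).
have {bb'}: forall w', e b w' -> linked B b w'.
  move=> {}w' ebw'; have w'b : w' != b by apply: contraTneq ebw' => ->; rewrite e_irr.
  have w'in : w' \in setT :\ b by rewrite !inE w'b.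
  have b'in : b' \in setT :\ b by rewrite !inE eq_sym bb'.
  have [p [pp lp sp]] := connect_path w'in (conn_minus w'in b'in).
  exists [::], p; split=> //; first by rewrite lp.
  by move=> t; rewrite inE => /eqP ->; apply/negP => /sp; rewrite !inE eqxx.
elim: q b {Bb} pq w' => [|x q IH] b /=; first by move=> _ w' ; apply.
by case/andP=> ebx pq w' Lb; apply: IH => // w2 exw2; apply: linked_step (Lb _ _).
Qed.

End Linked.

(** * Gluing two cycles along two disjoint paths *)

Lemma cycle_split (c : seq T) x y : x \in c -> y \in c -> x != y ->
  exists i p1 p2, rot i c = x :: p1 ++ y :: p2.
Proof.
move=> xc yc xy; case: (rot_to xc) => i s E; exists i.
have ys : y \in s by have:= yc; rewrite -(mem_rot i) E inE eq_sym (negPf xy).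
by case/splitPr: ys E => p1 p2 E; exists p1, p2.
Qed.

Lemma path_rcons_rev x p y : path e x (rcons p y) = path e y (rcons (rev p) x).
Proof. by rewrite -path_rev last_rcons belast_rcons rev_cons. Qed.

Lemma cycle_cat_split x p1 y p2 : cycle e (x :: p1 ++ y :: p2) =
  path e x (rcons p1 y) && path e y (rcons p2 x).
Proof. by rewrite /= rcons_cat -cat_rcons cat_path last_rcons. Qed.

(** The longer of the two arcs between [x] and [y] contains at least half of the edges of the cycle;
    it has [(size p).+1] of them. *)
Lemma long_arc c x y : uniq c -> cycle e c -> x \in c -> y \in c -> x != y ->
  exists p, [/\ path e x (rcons p y), uniq p, x \notin p, y \notin p
    & {subset p <= c} /\ size c <= (size p).+1.*2].
Proof.
move=> uc cc xc yc xy; have [i [p1 [p2 E]]] := cycle_split xc yc xy.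
have szc : size c = (size p1 + size p2).+2 by rewrite -(size_rot i) E /= size_cat /= addnS.
have sub t : t \in p1 ++ p2 -> t \in c.
  by rewrite -[t \in c](mem_rot i) E mem_cat inE mem_cat inE => /orP[]->; rewrite ?orbT.
move: cc uc; rewrite -(rot_cycle i) -(rot_uniq i) E cycle_cat_split => /andP[c1 c2].
rewrite cons_uniq mem_cat inE !negb_or cat_uniq cons_uniq /= negb_or.
case/and5P=> /and3P[x1 _ x2] u1 /andP[y1 _] y2 u2.
have [le|le] := leqP (size p2) (size p1).
  exists p1; split=> //; split; last by rewrite szc doubleS !ltnS -addnn leq_add2l.
  by move=> t t1; apply: sub; rewrite mem_cat t1.
exists (rev p2); rewrite rev_uniq !mem_rev size_rev; split=> //.
  by rewrite -path_rcons_rev.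
split; last by rewrite szc doubleS !ltnS -addnn leq_add2r ltnW.
by move=> t; rewrite mem_rev => t2; apply: sub; rewrite mem_cat t2 orbT.
Qed.

Lemma hasN_disjoint (a b : seq T) : (forall t, t \in a -> t \in b -> False) -> ~~ has (mem a) b.
Proof. by move=> dis; apply/hasPn => t tb; apply/negP => ta; apply: dis ta tb. Qed.

Lemma last_rev_belast x (q : seq T) : last (last x q) (rev (belast x q)) = x.
Proof. by case: q => //= y q; rewrite rev_cons last_rcons. Qed.

(** The new cycle follows the first path, the longer arc of [c'], the second path backwards and the
    longer arc of [c]. The last hypothesis covers both disjoint cycles and cycles sharing the single
    vertex [y1], in which case [s1] may be empty. Sizes are doubled to avoid halving. *)
Lemma glue_cycles c c' y1 s1 y2 s2 : is_cycle e c -> is_cycle e c' ->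
  path e y1 s1 -> path e y2 s2 -> uniq (y1 :: s1) -> uniq (y2 :: s2) ->
  y1 \in c -> y2 \in c -> last y1 s1 \in c' -> last y2 s2 \in c' ->
  (forall t, t \in y1 :: s1 -> t \notin y2 :: s2) ->
  (forall t, t \in y1 :: s1 -> t \in c -> t = y1) ->
  (forall t, t \in y2 :: s2 -> t \in c -> t = y2) ->
  (forall t, t \in y1 :: s1 -> t \in c' -> t = last y1 s1) ->
  (forall t, t \in y2 :: s2 -> t \in c' -> t = last y2 s2) ->
  (forall t, t \in c -> t \in c' -> t = y1) ->
  exists2 d, is_cycle e d & size c + size c' + (size s1 + size s2).*2 <= (size d).*2.
Proof.
move=> [uc szc cc] [uc' szc' cc'] p1 p2 u1 u2 y1c y2c z1c' z2c' dis d1 d2 d1' d2' dcc'.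
have y12 : y1 != y2.
  by apply: contraNneq (dis y1 (mem_head _ _)) => ->; exact: mem_head.
have z12 : last y1 s1 != last y2 s2.
  by apply: contraNneq (dis _ (mem_last y1 s1)) => ->; exact: mem_last.
have [p [pp up y1p y2p [sp szp]]] := long_arc uc cc y1c y2c y12.
have [p' [pp' up' z1p z2p [sp' szp']]] := long_arc uc' cc' z1c' z2c' z12.
pose d := (y1 :: s1) ++ p' ++ rev (y2 :: s2) ++ rev p.
have szd : size d = size s1 + size s2 + size p + size p' + 2.
  rewrite /d !size_cat !size_rev /=.
  by move: (size s1) (size s2) (size p) (size p') => ? ? ? ?; clear; lia.
have szd' : size c + size c' + (size s1 + size s2).*2 <= (size d).*2.
  rewrite szd; move: (size s1) (size s2) (size p) (size p') (size c) (size c') szp szp'.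
  by clear; lia.
exists d => //.
split; last 2 first.
- by move: szc szc' szd'; move: (size c) (size c') (size d) (_ + _).*2; clear; lia.
- rewrite /d (lastI y2) rev_rcons /= !rcons_cat /= !cat_path p1 /=.
  have /andP[-> ->] : path e (last y1 s1) p' && e (last (last y1 s1) p') (last y2 s2).
    by rewrite -rcons_path.
  by rewrite rcons_cat cat_path path_rev p2 last_rev_belast -path_rcons_rev.
rewrite /d !cat_uniq u1 up' !rev_uniq u2 up !has_cat !negb_or /= andbT.
do ![apply/andP; split]; apply: hasN_disjoint => t.
- by move=> t1 t2; have E := d1' _ t1 (sp' _ t2); rewrite E in t2; rewrite t2 in z1p.
- by move=> t1; rewrite mem_rev => t2; move: (dis _ t1); rewrite t2.
- by move=> t1; rewrite mem_rev => t2; move: (t2); rewrite (d1 _ t1 (sp _ t2)) (negPf y1p).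
- by move=> t1; rewrite mem_rev => t2; move: (t1); rewrite (d2' _ t2 (sp' _ t1)) (negPf z2p).
- by move=> t1; rewrite mem_rev => t2; move: (t2); rewrite (dcc' _ (sp _ t2) (sp' _ t1)) (negPf y1p).
- by rewrite !mem_rev => t1 t2; move: (t2); rewrite (d2 _ t1 (sp _ t2)) (negPf y2p).
Qed.

Lemma cycle_other c x : is_cycle e c -> exists2 y, y \in c & y != x.
Proof.
case=> uc szc _; case: c uc szc => [|y [|z c]] //= /andP[yz _] _.
have [yx|] := eqVneq y x; last by exists y; rewrite ?mem_head.
exists z; first by rewrite !inE eqxx orbT.
by move: yz; rewrite inE negb_or eq_sym yx => /andP[].
Qed.

Lemma longest_cycles_meet c c' : two_connected e ->
  longest_cycle e c -> longest_cycle e c' ->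
  1 < #|[set x in c] :&: [set x in c']|.
Proof.
move=> [_ conn conn_minus] [cyc max] [cyc' max']; rewrite ltnNge; apply/negP => /card_le1_eqP le1.
have szE : size c = size c' by apply/eqP; rewrite eqn_leq max // max'.
(* With a single common vertex [v], glue along the trivial path at [v] and a path between the cycles
   in the graph without [v]. *)
have [v /andP[vc vc']|none] := pickP [pred x | (x \in c) && (x \in c')].
  have [y yc yv] := cycle_other v cyc; have [z zc' zv] := cycle_other v cyc'.
  have yin : y \in setT :\ v by rewrite !inE yv.
  have zin : z \in setT :\ v by rewrite !inE zv.
  have [q [pq lq sq]] := connect_path yin (conn_minus _ _ _ yin zin).
  rewrite -lq in zc'.
  have [y2 [s2 [p2 u2 y2c z2c' [ss2 d2 d2']]]] := @clean_path (mem c) (mem c') _ _ pq yc zc'.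
  have s2v t : t \in y2 :: s2 -> t != v by move=> /ss2 /sq; rewrite !inE andbT.
  have dcc' t : t \in c -> t \in c' -> t = v.
    by move=> tc tc'; apply: le1; rewrite !inE ?tc ?vc.
  have s20 : 0 < size s2.
    case: (s2) z2c' s2v => // /(dcc' _ y2c) -> /(_ v (mem_head _ _)); by rewrite eqxx.
  have [||||||d cd] := @glue_cycles c c' v [::] y2 s2 cyc cyc' isT p2 isT u2 vc y2c vc' z2c'.
  - by move=> t; rewrite inE => /eqP ->; apply: contraT; rewrite negbK => /s2v; rewrite eqxx.
  - by move=> t; rewrite inE => /eqP ->.
  - exact: d2.
  - by move=> t; rewrite inE => /eqP ->.
  - exact: d2'.
  - exact: dcc'.
  move: (max _ cd) s20; rewrite /= -szE.
by move: (size c) (size d) (size s2); clear; lia.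
(* For disjoint cycles, the ends of an edge of [c] are linked to [c']. In both cases some connecting
   path has an edge, so the glued cycle is too long. *)
have [b [b' [bc b'c bb']]] : exists b b', [/\ b \in c', b' \in c' & b != b'].
  case: cyc' => u' sz' _; case: (c') u' sz' => [|b [|b' ?]] //= /andP[bb' _] _.
  exists b, b'; rewrite !inE !eqxx orbT; split=> //.
  by move: bb'; rewrite inE negb_or => /andP[].
have [w [w' [wc w'c eww']]] : exists w w', [/\ w \in c, w' \in c & e w w'].
  case: cyc => _ sz cc; case: (c) sz cc => [|w [|w' ?]] //= _ /andP[ww' _].
  by exists w, w'; rewrite !inE !eqxx orbT.
have [p [p' [pp pp' lp lp' dis]]] := linked_edge conn_minus conn (bc : mem c' b) b'c bb' eww'.
have [y1 [s1 [p1 u1 y1c z1c' [ss1 d1 d1']]]] := @clean_path (mem c) (mem c') _ _ pp wc lp.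
have [y2 [s2 [p2 u2 y2c z2c' [ss2 d2 d2']]]] := @clean_path (mem c) (mem c') _ _ pp' w'c lp'.
have s10 : 0 < size s1.
  by case: (s1) z1c' => //= y1c'; have /andP[] := none y1.
have [||d cd] := @glue_cycles c c' y1 s1 y2 s2 cyc cyc' p1 p2 u1 u2 y1c y2c z1c' z2c' _ d1 d2 d1' d2'.
- by move=> t /ss1 /dis; apply: contra => /ss2.
- by move=> t tc tc'; have := none t; rewrite /= tc tc'.
move: (max _ cd) s10; rewrite -szE.
by move: (size c) (size d) (size s1) (size s2); clear; lia.
Qed.

(** * Traces of longest cycles on a clique *)

Definition trace (K : {set T}) (c : seq T) := [set x in c] :&: K.

(* The quantification over [D] encodes that the traces of the longest cycles
   living in [H] are not all one and the same pair. *)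
Definition attracts (K H : {set T}) := forall D : {set T}, #|D| <= 2 ->
  exists c, [/\ longest_cycle e c, {subset c <= H :|: K}, #|trace K c| <= 2
    & #|trace K c :&: D| <= 1].

Lemma clique_edge (K : {set T}) x y : clique e K -> x \in K -> y \in K -> x != y -> e x y.
Proof. by move=> /forall_inP cl xK yK; have /forall_inP/(_ y yK)/implyP := cl x xK. Qed.

Section Segments.
Variable K : {set T}.
Hypothesis clK : clique e K.

(** The interior may be empty, so an edge of [K] is a segment. The ends may coincide, which is why
    [x != y] is stated separately below. *)
Definition segment x p y := [/\ x \in K, y \in K, path e x (rcons p y), uniq p
  & {in p, forall t, t \notin K}].

Lemma segment_rev x p y : segment x p y -> segment y (rev p) x.
Proof.
case=> xK yK pp up pK; split; rewrite ?rev_uniq // -?path_rcons_rev //.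
by move=> t; rewrite mem_rev; apply: pK.
Qed.

Lemma uniq_cat_outside ks ps : uniq ks -> {subset ks <= K} -> uniq ps ->
  {in ps, forall t, t \notin K} -> uniq (ks ++ ps).
Proof.
move=> uk kK up pK; rewrite cat_uniq uk up andbT; apply: hasN_disjoint => t /kK tK /pK.
by rewrite tK.
Qed.

(** The clique supplies the closing edge. This is what allows segments with ends in [K] to be
    recombined freely into cycles. *)
Lemma close_path x q : path e x q -> uniq (x :: q) -> x \in K -> last x q \in K ->
  2 <= size q -> is_cycle e (x :: q).
Proof.
move=> pq uq xK lK sq; split=> //=; rewrite rcons_path pq.
apply: (clique_edge clK) => //; apply/eqP => E; move: uq; rewrite cons_uniq -E.
by case: q sq {pq lK E} => //= y q _; rewrite mem_last.
Qed.

Lemma segment2_cycle x p y r z : segment x p y -> segment y r z ->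
  x != y -> y != z -> x != z -> uniq (p ++ r) ->
  exists2 d, is_cycle e d & size d = (size p + size r).+3.
Proof.
move=> [xK yK pp up pK] [_ zK pr ur rK] xy yz xz upr.
exists (x :: p ++ y :: rcons r z); last by rewrite /= size_cat /= size_rcons !addnS.
apply: close_path => //.
- by rewrite -cat_rcons cat_path pp last_rcons.
- rewrite (@perm_uniq _ _ ([:: x; y; z] ++ p ++ r)).
    apply: uniq_cat_outside => //; first by rewrite /= !inE negb_or xy xz yz.
      by move=> t; rewrite !inE => /or3P[]/eqP->.
    by move=> t; rewrite mem_cat => /orP[/pK|/rK].
  apply/permP => P; rewrite -cat1s !count_cat /= -cats1 !count_cat /=.
  by move: (count P p) (count P r) (P x) (P y) (P z); clear; lia.
- by rewrite last_cat /= last_rcons.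
by rewrite size_cat /= size_rcons !addnS.
Qed.

Lemma segment2_disjoint_cycle x p y z r w : segment x p y -> segment z r w ->
  uniq [:: x; y; z; w] -> uniq (p ++ r) ->
  exists2 d, is_cycle e d & size d = (size p + size r).+4.
Proof.
move=> [xK yK pp up pK] [zK wK pr ur rK] u4 upr.
exists (x :: p ++ y :: z :: rcons r w); last by rewrite /= size_cat /= size_rcons !addnS.
apply: close_path => //.
- rewrite -cat_rcons cat_path pp last_rcons /= pr andbT.
  apply: (clique_edge clK) => //; move: u4; rewrite /= !inE !negb_or.
  by case/and4P=> _ /andP[].
- rewrite (@perm_uniq _ _ ([:: x; y; z; w] ++ p ++ r)).
    apply: uniq_cat_outside => //.
      by move=> t; rewrite !inE => /or4P[]/eqP->.
    by move=> t; rewrite mem_cat => /orP[/pK|/rK].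
  apply/permP => P; rewrite -cat1s !count_cat /= -cats1 !count_cat /=.
  by move: (count P p) (count P r) (P x) (P y) (P z) (P w); clear; lia.
- by rewrite last_cat /= last_rcons.
by rewrite size_cat /= size_rcons !addnS.
Qed.

Lemma segment3_cycle x p y r z s w : segment x p y -> segment y r z ->
  segment z s w -> uniq [:: x; y; z; w] -> uniq (p ++ r ++ s) ->
  exists2 d, is_cycle e d & size d = (size p + size r + size s).+4.
Proof.
move=> [xK yK pp up pK] [_ zK pr ur rK] [_ wK ps us sK] u4 uprs.
exists (x :: p ++ y :: r ++ z :: rcons s w); last first.
  by rewrite /= size_cat /= size_cat /= size_rcons !addnS addnA.
apply: close_path => //.
- by rewrite -cat_rcons cat_path pp last_rcons -cat_rcons cat_path pr last_rcons.
- rewrite (@perm_uniq _ _ ([:: x; y; z; w] ++ p ++ r ++ s)).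
    apply: uniq_cat_outside => //.
      by move=> t; rewrite !inE => /or4P[]/eqP->.
    by move=> t; rewrite !mem_cat => /or3P[/pK|/rK|/sK].
  apply/permP => P; rewrite -cat1s !count_cat /= !count_cat /= -cats1 !count_cat /=.
  by move: (count P p) (count P r) (count P s) (P x) (P y) (P z) (P w); clear; lia.
- by rewrite last_cat /= last_cat /= last_rcons.
by rewrite size_cat /= size_cat /= size_rcons !addnS.
Qed.

Lemma trace2_segments c x y : is_cycle e c -> x \in K -> y \in K -> x \in c ->
  y \in c -> x != y -> (forall t, t \in c -> t \in K -> t \in [:: x; y]) ->
  exists r1 r2, [/\ segment x r1 y, segment y r2 x, size c = (size r1 + size r2).+2
    & forall t, t \in c -> (t \in K) || (t \in r1 ++ r2)].
Proof.
move=> [uc _ cc] xK yK xc yc xy tr; have [i [r1 [r2 E]]] := cycle_split xc yc xy.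
have memE t : t \in c = (t \in x :: r1 ++ y :: r2) by rewrite -(mem_rot i) E.
move: cc uc; rewrite -(rot_cycle i) -(rot_uniq i) E cycle_cat_split => /andP[c1 c2].
rewrite cons_uniq mem_cat inE !negb_or cat_uniq cons_uniq /= negb_or.
case/and5P=> /and3P[x1 _ x2] u1 /andP[y1 _] y2 u2.
have out t : t \in r1 ++ r2 -> t \notin K.
  move=> tr12; apply/negP => tK.
  have tc : t \in c.
    by rewrite memE inE mem_cat inE; move: tr12; rewrite mem_cat => /orP[]->; rewrite !orbT.
  move: tr12; have := tr t tc tK; rewrite !inE mem_cat => /orP[]/eqP->.
    by rewrite (negPf x1) (negPf x2).
  by rewrite (negPf y1) (negPf y2).
exists r1, r2; split.
- by split=> // t t1; apply: out; rewrite mem_cat t1.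
- by split=> // t t2; apply: out; rewrite mem_cat t2 orbT.
- by rewrite -(size_rot i) E /= size_cat /= addnS.
move=> t; rewrite memE inE mem_cat inE mem_cat.
by case/or4P=> [/eqP->|->|/eqP->|->]; rewrite ?xK ?yK ?orbT.
Qed.

(** The order [x], [y], [z] can be imposed because a cycle through three vertices may be read in
    either direction. Disjointness is recorded only for the two segments that are kept when the
    middle one is exchanged. *)
Lemma trace3_segments c x y z : is_cycle e c -> x \in K -> y \in K -> z \in K ->
  x \in c -> y \in c -> z \in c -> uniq [:: x; y; z] ->
  (forall t, t \in c -> t \in K -> t \in [:: x; y; z]) ->
  exists r1 r2 r3, [/\ segment x r1 y, segment y r2 z, segment z r3 x,
    uniq (r1 ++ r3) & size c = (size r1 + size r2 + size r3).+3].
Proof.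
move=> [uc _ cc] xK yK zK xc yc zc u3 tr.
have xy : x != y by move: u3; rewrite /= !inE negb_or => /and3P[/andP[]].
have [i [p1 [p2 E]]] := cycle_split xc yc xy.
have memE t : t \in c = (t \in x :: p1 ++ y :: p2) by rewrite -(mem_rot i) E.
have szE : size c = (size p1 + size p2).+2.
  by rewrite -(size_rot i) E /= size_cat /= addnS.
move: cc uc; rewrite -(rot_cycle i) -(rot_uniq i) E => cc uc.
have zp : (z \in p1) || (z \in p2).
  move: u3 zc; rewrite memE /= !inE !negb_or => /and3P[/andP[_ xz] yz _].
  by rewrite mem_cat inE eq_sym (negPf xz) (eq_sym z) (negPf yz).
have build u v w q1 q2 q3 :
    perm_eq [:: u; v; w] [:: x; y; z] -> cycle e (u :: q1 ++ v :: q2 ++ w :: q3) ->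
    perm_eq (x :: p1 ++ y :: p2) ([:: u; v; w] ++ q1 ++ q2 ++ q3) ->
    [/\ segment u q1 v, segment v q2 w, segment w q3 u, uniq (q1 ++ q2 ++ q3)
     & size c = (size q1 + size q2 + size q3).+3].
  move=> P3 cyc P; rewrite cycle_cat_split rcons_cat /= -cat_rcons cat_path last_rcons in cyc.
  case/and3P: cyc => c1 c2 c3.
  move: uc; rewrite (perm_uniq P) cat_uniq => /and3P[_ /hasPn dis uq].
  have kK t : t \in [:: u; v; w] -> t \in K.
    by rewrite (perm_mem P3) !inE => /or3P[]/eqP->.
  have out t : t \in q1 ++ q2 ++ q3 -> t \notin K.
    move=> tq; apply/negP => tK; apply: (negP (dis t tq)).
    change (t \in [:: u; v; w]); rewrite (perm_mem P3); apply: tr => //.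
    by rewrite memE (perm_mem P) mem_cat tq orbT.
  have [uK vK wK] : [/\ u \in K, v \in K & w \in K].
    by split; apply: kK; rewrite !inE eqxx ?orbT.
  have [uq1 uq2 uq3] : [/\ uniq q1, uniq q2 & uniq q3].
    by move: uq; rewrite !cat_uniq => /and3P[? _ /and3P[]].
  split=> //.
  - by split=> // t tq; apply: out; rewrite mem_cat tq.
  - by split=> // t tq; apply: out; rewrite !mem_cat tq orbT.
  - by split=> // t tq; apply: out; rewrite !mem_cat tq !orbT.
  by rewrite szE; have := perm_size P; rewrite /= !size_cat /= addnS addnA => ->.
have uniq13 (q1 q2 q3 : seq T) : uniq (q1 ++ q2 ++ q3) -> uniq (q1 ++ q3).
  by rewrite uniq_catCA cat_uniq => /and3P[].
case/orP: zp => zp.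
  (* Here the cycle visits [x], [z], [y] in this order, so all three segments are reversed. *)
  case/splitPr: zp cc {szE uc memE E} build => q1 q2 cc build.
  have [|||s1 s2 s3 uq sz] := build x z y q1 q2 p2.
  - by apply/permP => P /=; move: (P x) (P y) (P z); clear; lia.
  - have -> // : x :: q1 ++ z :: q2 ++ y :: p2 = x :: (q1 ++ z :: q2) ++ y :: p2.
    by rewrite -catA.
  - apply/permP => P /=; do 3?rewrite !count_cat /=.
    by move: (count P q1) (count P q2) (count P p2) (P x) (P y) (P z); clear; lia.
  exists (rev p2), (rev q2), (rev q1); split; try exact: segment_rev.
    by rewrite -rev_cat rev_uniq (uniq13 _ _ _ uq).
  by rewrite sz !size_rev; move: (size q1) (size q2) (size p2); clear; lia.
case/splitPr: zp cc {szE uc memE E} build => q2 q3 cc build.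
have [|||s1 s2 s3 uq sz] := build x y z p1 q2 q3.
- exact: perm_refl.
- exact: cc.
- apply/permP => P /=; do 3?rewrite !count_cat /=.
  by move: (count P q2) (count P q3) (count P p1) (P x) (P y) (P z); clear; lia.
by exists p1, q2, q3; split=> //; apply: uniq13 uq.
Qed.

Lemma trace_mem c x : (x \in trace K c) = (x \in c) && (x \in K).
Proof. by rewrite !inE. Qed.

Lemma uniq_cat_disjoint (p r : seq T) : uniq p -> uniq r ->
  (forall t, t \in r -> t \notin p) -> uniq (p ++ r).
Proof.
by move=> up ur dis; rewrite cat_uniq up ur andbT; apply: hasN_disjoint => t tp /dis; rewrite tp.
Qed.

(* The case [d = a] is allowed; it rules out the two-element set [{a, c}] and
   is what serves cliques of size three. *)
Lemma swap_longest_segment a p b c d C :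
  segment a p b -> a != b ->
  (forall x r y, segment x r y -> x != y -> size r <= size p) ->
  c \in K -> c != a -> c != b ->
  (forall r y t, segment c r y -> t \in r -> t \notin p) ->
  d \in K -> d != b -> d != c ->
  longest_cycle e C -> 2 <= #|trace K C| ->
  (forall t, t \in C -> t \in K -> t \in [:: a; c; d]) ->
  trace K C = [set a; d] /\
  exists r1 r2, [/\ segment a r1 d, segment d r2 a, has (mem p) r1, has (mem p) r2
    & forall t, t \in C -> (t \in K) || (t \in r1 ++ r2)].
Proof.
move=> sp ab mp cK ca cb hc dK db dc [cyC maxC] tr2 tr.
have [aK bK _ up _] := sp.
have revp : segment b (rev p) a by apply: segment_rev.
have urp (r : seq T) : uniq r -> (forall t, t \in r -> t \notin p) -> uniq (rev p ++ r).
  move=> ur dis; apply: uniq_cat_disjoint; rewrite ?rev_uniq // => t /dis.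
  by rewrite mem_rev.
have seg_uniq x r y : segment x r y -> uniq r by case.
(* Follow [p] from [b] to [a], then [r] to [z], and return by the clique edge [z b]. *)
have join r z : segment a r z -> z != a -> z != b -> (forall t, t \in r -> t \notin p) ->
    (size p + size r).+3 <= size C.
  move=> sr za zb dis; have [|||| d' cd szd] := segment2_cycle revp sr; last first.
  - by have := maxC _ cd; rewrite szd size_rev.
  - by apply: urp => //; apply: seg_uniq sr.
  - by rewrite eq_sym.
  - by rewrite eq_sym.
  - by rewrite eq_sym.
have cC : c \notin C.
  apply/negP => cC.
  (* Trace [{a, c}]: the arc [r2] is no longer than [p], so replacing it by [p] gains at least the
     vertex [b]. *)
  have [daC|] := boolP ((a \in C) && ((d == a) || (d \notin C))).
    have /andP[aC daC'] := daC.
    have [|r1 [r2 [s1 s2 sz _]]] := @trace2_segments C c a cyC cK aK cC aC ca.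
      move=> t tC /(tr t tC); rewrite !inE => /or3P[->|->|/eqP td]; rewrite ?orbT //.
      by move: tC daC'; rewrite td => ->; rewrite orbF => /eqP ->; rewrite eqxx orbT.
    have r1p t : t \in rev r1 -> t \notin p by rewrite mem_rev; apply: hc s1.
    have := join _ _ (segment_rev s1) ca cb r1p.
    have := mp _ _ _ s2; rewrite eq_sym ca sz size_rev => /(_ isT).
    by move: (size p) (size r1) (size r2); clear; lia.
  have [aC|aC] := boolP (a \in C); rewrite /= ?negb_or ?negbK.
    case/andP=> da dC.
    (* Trace [{a, c, d}]: replace the segment [r2] between [a] and [d] by [p] and [b]. The other two
       end at [c], hence avoid [p]. *)
    have [||r1 [r2 [r3 [s1 s2 s3 ur13 sz]]]] := @trace3_segments C c a d cyC cK aK dK cC aC dC.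
    - by rewrite /= !inE negb_or ca eq_sym dc eq_sym da.
    - by move=> t tC /(tr t tC); rewrite !inE orbCA.
    have u4 : uniq [:: b; a; c; d].
      rewrite /= !inE !negb_or ![b == _]eq_sym ![a == _]eq_sym (eq_sym c d).
      by rewrite ca cb da db dc eq_sym ab.
    have [|d' cd szd] := segment3_cycle revp (segment_rev s1) (segment_rev s3) u4.
      apply: urp; first by rewrite -rev_cat rev_uniq uniq_catC.
      move=> t; rewrite mem_cat !mem_rev => /orP[]; first exact: hc s1.
      by rewrite -mem_rev; apply: hc (segment_rev s3).
    have := maxC _ cd; have := mp _ _ _ s2; rewrite szd sz !size_rev eq_sym da => /(_ isT).
    by move: (size p) (size r1) (size r2) (size r3); clear; lia.
  (* Trace [{c, d}]: replace [r2] by [p] together with both of its ends, attached by clique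
     edges. *)
  move=> _; have [dC|dC] := boolP (d \in C).
    have cd : c != d by rewrite eq_sym.
    have [|r1 [r2 [s1 s2 sz _]]] := @trace2_segments C c d cyC cK dK cC dC cd.
      move=> t tC /(tr t tC); rewrite !inE => /or3P[/eqP ta|->|->]; rewrite ?orbT //.
      by rewrite -ta tC in aC.
    have da : d != a by apply: contraTneq dC => ->.
    have u4 : uniq [:: b; a; c; d].
      rewrite /= !inE !negb_or ![b == _]eq_sym ![a == _]eq_sym (eq_sym c d).
      by rewrite ca cb da db dc eq_sym ab.
    have [|d' cd' szd] := segment2_disjoint_cycle revp s1 u4.
      by apply: urp; [apply: seg_uniq s1 | move=> t; apply: hc s1].
    have := maxC _ cd'; have := mp _ _ _ s2; rewrite szd sz size_rev dc => /(_ isT).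
    by move: (size p) (size r1) (size r2); clear; lia.
  move: tr2; rewrite leqNgt => /negP[]; rewrite ltnS -(cards1 c).
  apply/subset_leq_card/subsetP => t; rewrite trace_mem inE => /andP[tC tK].
  have := tr t tC tK; rewrite !inE => /or3P[/eqP E|//|/eqP E].
    by rewrite -E tC in aC.
  by rewrite -E tC in dC.
have sub : trace K C \subset [set a; d].
  apply/subsetP => t; rewrite trace_mem !inE => /andP[tC tK].
  have := tr t tC tK; rewrite !inE => /or3P[->//|/eqP E|->]; rewrite ?orbT //.
  by rewrite -E tC in cC.
have ad : a != d.
  apply: contraTneq tr2 => E; rewrite -ltnNge ltnS -(cards1 d).
  by rewrite -[[set d]]setUid -{1}E; apply: subset_leq_card.
have trE : trace K C = [set a; d].
  by apply/eqP; rewrite eqEcard sub cards2 ad.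
split=> //.
have /andP[aC _] : (a \in C) && (a \in K) by rewrite -trace_mem trE !inE eqxx.
have /andP[dC _] : (d \in C) && (d \in K) by rewrite -trace_mem trE !inE eqxx orbT.
have [|r1 [r2 [s1 s2 sz cov]]] := @trace2_segments C a d cyC aK dK aC dC ad.
  by move=> t tC tK; have := subsetP sub t; rewrite trace_mem tC tK !inE; apply.
exists r1, r2; split=> //.
  (* An arc avoiding [p] could be kept while [p] and [b] replace the other arc. *)
  apply: contraT => /hasPn dis.
  have := join _ _ s1; rewrite eq_sym ad db => /(_ isT isT dis).
  have := mp _ _ _ s2; rewrite eq_sym ad sz => /(_ isT).
  by move: (size p) (size r1) (size r2); clear; lia.
apply: contraT => /hasPn dis.
have dis' t : t \in rev r2 -> t \notin p by rewrite mem_rev; apply: dis.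
have := join _ _ (segment_rev s2); rewrite eq_sym ad db => /(_ isT isT dis').
have := mp _ _ _ s1; rewrite ad sz size_rev => /(_ isT).
by move: (size p) (size r1) (size r2); clear; lia.
Qed.

Lemma outside_connect h q : path e h q -> {in h :: q, forall t, t \notin K} ->
  forall t, t \in h :: q -> connect (induced_rel e (~: K)) h t.
Proof.
by move=> pq qK; apply: induced_path_connect => // t /qK tK; rewrite inE.
Qed.

Lemma segment_component x r y t z : segment x r y -> t \in r ->
  t \in component K z -> {subset r <= component K z}.
Proof.
case=> _ _ pr _ rK tr tz s sr; case: r pr rK tr sr => // h r.
rewrite /= rcons_path => /and3P[_ pr _] rK tr sr; move: tz; rewrite !inE => /connect_trans; apply.
apply: connect_trans (outside_connect pr rK sr).
by rewrite induced_connect_sym; apply: outside_connect pr rK _ tr.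
Qed.

Lemma small_trace_component C : longest_cycle e C -> #|trace K C| <= 1 ->
  exists2 z, z \notin K & {subset C <= component K z :|: K}.
Proof.
move=> [[uC szC cC] _] /card_le1_eqP tr1.
have [x xC xtr] : exists2 x, x \in C & forall t, t \in C -> t \in K -> t = x.
  have [x|none] := pickP [pred x | x \in trace K C].
    move=> /= xt; exists x; first by move: xt; rewrite trace_mem => /andP[].
    by move=> t tC tK; apply: tr1; rewrite // trace_mem tC.
  case: C uC szC cC tr1 none => // x C _ _ _ _ none; exists x; first exact: mem_head.
  by move=> t tC tK; have:= none t; rewrite /= trace_mem tC tK.
case: (rot_to xC) => i [|h q] E; first by have := size_rot i C; rewrite E => s1; rewrite -s1 in szC.
have memE t : t \in C = (t \in [:: x, h & q]) by rewrite -(mem_rot i) E.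
move: uC cC; rewrite -(rot_uniq i) -(rot_cycle i) E cons_uniq => /andP[xq _].
rewrite /= rcons_path => /and3P[exh pq _].
have qK : {in h :: q, forall t, t \notin K}.
  move=> t tq; apply: contraNN xq => tK; rewrite -(xtr t) //.
  by rewrite memE inE tq orbT.
have hK : h \notin K by apply: qK; exact: mem_head.
exists h => // t; rewrite memE inE in_setU => /predU1P[->|tq]; last first.
  by rewrite inE (outside_connect pq qK).
have [|xK] := boolP (x \in K); first by rewrite orbT.
by rewrite (component_step hK (component_id _ h)) // e_sym.
Qed.

Lemma longest_segment_exists x0 y0 : x0 \in K -> y0 \in K -> x0 != y0 ->
  exists a p b, [/\ segment a p b, a != b
   & forall x r y, segment x r y -> x != y -> size r <= size p].
Proof.
move=> x0K y0K xy0.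
have s0 : segment x0 [::] y0 by split=> //=; rewrite (clique_edge clK).
(* Either a longest segment exists or there are segments of every length; the number of vertices
   excludes the latter. *)
have grow n : (exists a p b, [/\ segment a p b, a != b
      & forall x r y, segment x r y -> x != y -> size r <= size p]) \/
    exists a p b, [/\ segment a p b, a != b & n <= size p].
  elim: n => [|n [IH|[a [p [b [sp ab np]]]]]]; [by right; exists x0, [::], y0 | by left |].
  have [[x [r [y [sr xy nr]]]]|Nbig] :=
    classic (exists x r y, [/\ segment x r y, x != y & n < size r]).
    by right; exists x, r, y.
  left; exists a, p, b; split=> // x r y sr xy; apply: leq_trans np.
  by rewrite leqNgt; apply/negP => nr; apply: Nbig; exists x, r, y.
case: (grow #|T|.+1) => // [[a [p [b [[_ _ _ up _] _]]]]].
by rewrite leqNgt ltnS -(card_uniqP up) max_card.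
Qed.

End Segments.

(** Otherwise the vertex of the component dominating the attachment would be adjacent to all of [K],
    against maximality. *)
Lemma outside_neighbour_exists (K : {set T}) z : chordal e -> maxset (clique e) K ->
  z \notin K -> exists2 c, c \in K & c \notin attachment (component K z) K.
Proof.
move=> che /maxsetP[clK maxK] zK.
have [v vH vdom] := component_dominating zK che clK.
have vK := component_notin zK vH.
have [/subsetP sub|/subsetPn[c cK cN]] := boolP (K \subset attachment (component K z) K).
  have cl' : clique e (v |: K).
    apply/forall_inP => x xv; apply/forall_inP => y yv; apply/implyP => xy.
    move: xv yv xy; rewrite !inE => /predU1P[->|xK] /predU1P[->|yK]; first by rewrite eqxx.
    - by move=> _; apply: vdom; apply: sub.
    - by move=> _; rewrite e_sym; apply: vdom; apply: sub.
    exact: (clique_edge clK).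
  by move: vK; rewrite -(maxK _ cl' (subsetUr _ _)) setU11.
by exists c.
Qed.

Lemma bad_clique_attracts (K : {set T}) : chordal e -> maxset (clique e) K -> K != set0 ->
  (forall S : {set T}, #|S| <= maxn 1 (#|K| - 3) ->
     exists2 C, longest_cycle e C & forall x, x \in C -> x \notin S) ->
  exists2 z, z \notin K & attracts K (component K z).
Proof.
move=> che mK K0 bad; have clK := maxsetp mK.
have [[C lC trC]|large] := classic (exists2 C, longest_cycle e C & #|trace K C| <= 1).
  have [z zK sub] := small_trace_component lC trC; exists z => // D _; exists C; split=> //.
    exact: leq_trans trC _.
  by apply: leq_trans trC; apply: subset_leq_card; apply: subsetIl.
have {}large C : longest_cycle e C -> 2 <= #|trace K C|.
  by move=> lC; rewrite ltnNge; apply/negP => ?; apply: large; exists C.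
(* For a clique of at most two vertices, a longest cycle avoiding one of them would have a trace of
   size at most one. *)
have K3 : 2 < #|K|.
  rewrite ltnNge; apply/negP => K2; have /set0Pn[s sK] := K0.
  have [|C lC CS] := bad [set s]; first by rewrite cards1 leq_max.
  have := large C lC; rewrite ltnNge => /negP[].
  have: #|trace K C| <= #|K :\ s|.
    apply/subset_leq_card/subsetP => t; rewrite trace_mem !inE => /andP[tC ->].
    by rewrite andbT; have := CS t tC; rewrite inE.
  by move/leq_trans; apply; move: K2; rewrite (cardsD1 s) sK.
have [x0 x0K] := set0Pn _ K0.
have [y0] : exists y0, y0 \in K :\ x0.
  by apply/set0Pn; rewrite -card_gt0; move: K3; rewrite (cardsD1 x0) x0K; case: #|_|.
rewrite !inE eq_sym => /andP[xy0 y0K].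
have [a [p [b [sp ab mp]]]] := longest_segment_exists clK x0K y0K xy0.
have [aK bK pp up pK] := sp.
(* If [p] is empty, any third vertex of [K] serves as [c]. Otherwise take one without neighbours in
   the component of [p]: a segment meeting [p] has both ends attached to that component. *)
have [c [cK ca cb hc]] : exists c, [/\ c \in K, c != a, c != b
    & forall r y t, segment K c r y -> t \in r -> t \notin p].
  case: p {mp} sp pp up pK => [|h p] sp pp up pK.
    have [c] : exists c, c \in K :\: [set a; b].
      apply/set0Pn; rewrite -card_gt0 cardsD subn_gt0; apply: leq_ltn_trans K3.
      by apply: leq_trans (subset_leq_card (subsetIr _ _)) _; rewrite cards2; case: (_ != _).
    by rewrite !inE negb_or => /andP[/andP[ca cb] cK]; exists c; split.
  have hK : h \notin K by apply: pK; exact: mem_head.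
  have [c cK cN] := outside_neighbour_exists che mK hK.
  have hH : h \in component K h by apply: component_id.
  have pH := segment_component sp (mem_head _ _) hH.
  have att x r y t : segment K x r y -> t \in r -> t \in h :: p ->
      x \in attachment (component K h) K.
    move=> sr tr tp; have rH := segment_component sr tr (pH _ tp).
    case: sr => xK _ pr _ _; rewrite inE xK; case: r pr tr rH => // g r /andP[exg _] _ rH.
    by apply/exists_inP; exists g => //; apply: rH; exact: mem_head.
  exists c; split=> //.
  - by apply: contraNneq cN => ->; apply: att sp (mem_head _ _) (mem_head _ _).
  - apply: contraNneq cN => ->; apply: att (segment_rev sp) _ (mem_head _ _).
    by rewrite mem_rev mem_head.
  - by move=> r y t sr tr; apply: contraNN cN => tp; apply: att sr tr tp.
(* When [K] is [{a, b, c}], a longest cycle avoiding [b] is handled by the swap with [d = a], which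
   forces the trace to be [{a}], too small. *)
have [K3'|K4] := leqP #|K| 3.
  have KE : [set a; b; c] = K.
    apply/eqP; rewrite eqEcard; apply/andP; split.
      by apply/subsetP => t; rewrite !inE => /orP[/orP[]|]/eqP->.
    apply: leq_trans K3' _.
    by rewrite -setUA cardsU1 cards2 !inE negb_or ab (eq_sym a) ca eq_sym cb.
  have [|C lC CS] := bad [set b]; first by rewrite cards1 leq_max.
  have [||trE _] := @swap_longest_segment K clK a p b c a C sp ab mp cK ca cb hc aK ab _ lC (large _ lC).
  - by rewrite eq_sym.
  - move=> t tC; rewrite -KE !inE => /orP[/orP[]|]/eqP E; rewrite E ?eqxx ?orbT //.
    by have := CS t tC; rewrite inE E eqxx.
  by have := large _ lC; rewrite trE setUid cards1.
have [d] : exists d, d \in K :\: [set a; b; c].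
  apply/set0Pn; rewrite -card_gt0 cardsD subn_gt0; apply: leq_ltn_trans K4.
  apply: leq_trans (subset_leq_card (subsetIr _ _)) _.
  by rewrite -setUA cardsU1 cards2; do 2!case: (~~ _).
rewrite !inE !negb_or => /andP[/andP[/andP[da db] dc] dK].
have avoid x : x \in K -> x != c -> x != d -> exists2 C, longest_cycle e C &
    forall t, t \in C -> t \in K -> t \in [:: x; c; d].
  move=> xK xc xd; have [|C lC CS] := bad (K :\: [set x; c; d]).
    rewrite leq_max cardsD; apply/orP; right; apply: leq_sub2l.
    have -> : K :&: [set x; c; d] = [set x; c; d].
      by apply/setIidPr/subsetP => t; rewrite !inE => /orP[/orP[]|]/eqP->.
    by rewrite -setUA cardsU1 cards2 !inE negb_or xc xd eq_sym dc.
  exists C => // t tC tK; have := CS t tC.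
  by rewrite !inE tK andbT negbK orbA.
have [||Ca lCa Ca_tr] := avoid a aK; rewrite 1?eq_sym //.
have [||Cb lCb Cb_tr] := avoid b bK; rewrite 1?eq_sym //.
have mp' x r y : segment K x r y -> x != y -> size r <= size (rev p).
  by rewrite size_rev; apply: mp.
have hc' r y t : segment K c r y -> t \in r -> t \notin rev p.
  by rewrite mem_rev; apply: hc.
have ba : b != a by rewrite eq_sym.
have [trA [r1 [r2 [s1 s2 h1 h2 covA]]]] :=
  swap_longest_segment clK sp ab mp cK ca cb hc dK db dc lCa (large _ lCa) Ca_tr.
have [trB [q1 [q2 [u1 u2 g1 g2 covB]]]] :=
  swap_longest_segment clK (segment_rev sp) ba mp' cK cb ca hc' dK da dc lCb (large _ lCb) Cb_tr.
have /hasP[z zr1 zp] := h1.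
have zK : z \notin K by apply: pK.
have pH := segment_component sp zp (component_id K z).
have inH x r y : segment K x r y -> has (mem p) r -> {subset r <= component K z}.
  by move=> sr /hasP[t tr tp]; apply: segment_component sr tr (pH _ tp).
have g1' : has (mem p) q1 by rewrite -(@eq_has _ (mem (rev p))) // => t; rewrite /= mem_rev.
have g2' : has (mem p) q2 by rewrite -(@eq_has _ (mem (rev p))) // => t; rewrite /= mem_rev.
exists z => // D D2.
have cover C' l1 l2 : (forall t, t \in C' -> (t \in K) || (t \in l1 ++ l2)) ->
    {subset l1 <= component K z} -> {subset l2 <= component K z} ->
    {subset C' <= component K z :|: K}.
  move=> cov i1 i2 t /cov; rewrite in_setU mem_cat => /or3P[->|/i1->|/i2->//]; by rewrite ?orbT.
(* [Ca] serves unless [D] is exactly [{a, d}]; then [Cb] does, since [{b, d}] meets [{a, d}] only in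
   [d]. *)
have [Dad|Dad] := leqP #|[set a; d] :&: D| 1.
  exists Ca; rewrite trA cards2; split=> //; last by case: (_ != _).
  exact: cover covA (inH _ _ _ s1 h1) (inH _ _ _ s2 h2).
exists Cb; rewrite trB cards2; split=> //; [|by case: (_ != _)|].
  exact: cover covB (inH _ _ _ u1 g1') (inH _ _ _ u2 g2').
have DE : [set a; d] = D.
  have /setIidPl sub : [set a; d] :&: D = [set a; d].
    by apply/eqP; rewrite eqEcard subsetIl cards2 eq_sym da.
  by apply/eqP; rewrite eqEcard sub cards2 eq_sym da.
rewrite -DE; apply: leq_trans (_ : #|[set d]| <= 1); last by rewrite cards1.
apply/subset_leq_card/subsetP => t; rewrite !inE => /andP[/orP[]/eqP-> //].
by rewrite (negPf ba) eq_sym (negPf db).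
Qed.
(** * Descent *)

(** A vertex of the cycle in [K] without neighbours in [H] has both its cycle neighbours in [K], so
    the trace has at least three vertices. *)
Lemma cycle_sub_attachment (K : {set T}) H C : is_cycle e C -> {subset C <= H :|: K} ->
  #|trace K C| <= 2 -> {subset C <= H :|: attachment H K}.
Proof.
move=> [uC szC cC] sub tr2 y yC; have := sub y yC.
rewrite !in_setU => /orP[->//|yK]; apply/orP; right; rewrite inE yK.
apply: contraLR tr2 => Natt; rewrite -ltnNge.
have nbK t : t \in C -> e y t -> t \in K.
  move=> tC eyt; have := sub t tC; rewrite in_setU => /orP[tH|//].
  by case/negP: Natt; apply/exists_inP; exists t.
case: (rot_to yC) => i s E.
have memE t : t \in C = (t \in y :: s) by rewrite -(mem_rot i) E.
move: uC szC cC; rewrite -(rot_uniq i) -(rot_cycle i) -(size_rot i) E.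
case/lastP: s E memE => [//|[|h s] l] E memE //=.
rewrite !inE mem_rcons !inE !negb_or => /andP[/and3P[yh yl _] /andP[hs _]] _.
rewrite !rcons_path last_rcons => /and3P[eyh _ ely].
have hC : h \in C by rewrite memE !inE eqxx orbT.
have lC : l \in C by rewrite memE !inE mem_rcons inE eqxx !orbT.
have hl : h != l by apply: contraNneq hs => ->; rewrite mem_rcons mem_head.
have -> : 3 = #|[set y; h; l]| by rewrite -setUA cardsU1 cards2 !inE negb_or yh yl hl.
apply/subset_leq_card/subsetP => t; rewrite trace_mem !inE => /orP[/orP[]|]/eqP->.
- by rewrite yC.
- by rewrite hC nbK.
- by rewrite lC nbK // e_sym.
Qed.

Lemma no_attracting_clique (K : {set T}) z : two_connected e -> chordal e ->
  (forall K, maxset (clique e) K -> exists2 z, z \notin K & attracts K (component K z)) ->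
  maxset (clique e) K -> z \notin K -> ~ attracts K (component K z).
Proof.
move=> h2c che all_attract.
have [n] := ubnP #|component K z|; elim: n K z => // n IH K z Hn mK zK attK.
set H := component K z in Hn attK; have clK := maxsetp mK.
have [v vH vdom] := component_dominating zK che clK; rewrite -/H in vH vdom.
set X := attachment H K in vdom.
have XK x : x \in X -> x \in K by rewrite inE => /andP[].
have clX : clique e (v |: X).
  apply/forall_inP => x xv; apply/forall_inP => y yv; apply/implyP => xy.
  move: xv yv xy; rewrite !in_setU !in_set1 => /predU1P[->|xX] /predU1P[->|yX].
  - by rewrite eqxx.
  - by move=> _; apply: vdom.
  - by move=> _; rewrite e_sym; apply: vdom.
  by apply: (clique_edge clK); apply: XK.
have [K' mK' sK'] := maxset_exists clX.
have vK' : v \in K' by apply: (subsetP sK'); rewrite setU11.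
have XK' x : x \in X -> x \in K' by move=> xX; apply: (subsetP sK'); rewrite setU1r.
have [z' z'K' attK'] := all_attract K' mK'.
set H' := component K' z' in attK'.
(* An edge leaving [H] ends in [X], which lies in [K']; hence a component of the complement of [K']
   that meets [H] stays inside [H]. It is strictly smaller, as [v] lies in [K']. *)
have stepH y y' : y \in H -> e y y' -> y' \notin K' -> y' \in H.
  move=> yH eyy' y'K'; have := component_neighbour zK yH eyy'.
  by rewrite in_setU => /orP[//|/XK']; rewrite (negPf y'K').
have [/pred0P dis|] := boolP [disjoint H & H']; last first.
  case/pred0Pn => y /andP[/= yH yH'].
  apply: (IH K' z' _ mK' z'K' attK'); apply: leq_trans (_ : #|H| <= n); last by [].
  apply/proper_card/properP; split; last first.
    by exists v => //; apply/negP => /(component_notin z'K'); rewrite vK'.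
  apply/subsetP => t tH'; have [q [pq <- sq]] := component_connect z'K' yH' tH'.
  elim: q y yH pq sq {yH'} => [//|w q IHq] y yH /= /andP[eyw pq] sq.
  apply: IHq pq _ => [|s sin]; last by apply: sq; rewrite inE sin orbT.
  apply: stepH yH eyw _; apply: (component_notin z'K').
  by apply: sq; rewrite !inE eqxx orbT.
have [|C' [lC' subC' tr2' _]] := attK' set0; first by rewrite cards0.
(* The trace of [C'] on [K'] plays the role of [D]. Every common vertex of [C] and [C'] turns out to
   lie in both traces, so there is at most one. *)
have [C [lC subC tr2 trD]] := attK _ tr2'.
have {}subC := cycle_sub_attachment lC.1 subC tr2.
have {}subC' := cycle_sub_attachment lC'.1 subC' tr2'.
have := longest_cycles_meet h2c lC lC'; rewrite ltnNge => /negP[].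
apply: leq_trans trD; apply/subset_leq_card/subsetP => t.
rewrite !in_setI !in_set => /andP[tC tC'].
have /setUP[tH|tX] := subC t tC; last by rewrite tC tC' XK // XK'.
have /setUP[tH'|] := subC' t tC'; first by have := dis t; rewrite /= tH tH'.
rewrite inE => /andP[_ /exists_inP[h hH' eth]].
have hH : h \in H by apply: stepH tH eth _; apply: component_notin z'K' _ hH'.
by have := dis h; rewrite /= hH hH'.
Qed.

End Graph.

Theorem theorem7p2 (T : finType) (e : rel T)
  (e_sym : symmetric e) (e_irr : irreflexive e)
  (h2c : two_connected e) (hch : chordal e) (n : nat) :
  is_lct e n -> n <= maxn 1 (omega e - 3).
Proof.
move=> [_ min_n]; rewrite leqNgt; apply/negP => lt_n.
have all_attract K : maxset (clique e) K ->
    exists2 z, z \notin K & attracts e K (component e K z).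
  move=> mK; have clK := maxsetp mK; apply: (bad_clique_attracts e_sym e_irr hch mK).
    have [T3 _ _] := h2c; have /card_gt0P[x _] : 0 < #|T| by apply: leq_trans T3.
    have clx : clique e [set x].
      apply/forall_inP => y /set1P->; apply/forall_inP => y' /set1P->.
      by rewrite eqxx.
    apply/eqP => K0; have := maxsetsup mK clx; rewrite K0 sub0set => /(_ isT)/setP/(_ x).
    by rewrite !inE eqxx.
  (* A set [S] meeting every longest cycle has at least [n] vertices, whereas its size is bounded
     through [#|K| <= omega e]. *)
  move=> S szS; apply: NNPP => noC.
  have hitS : hits_longest_cycles e S.
    move=> C lC; apply: contraT => /hasPn CS; case: noC; exists C => //.
  have := min_n S hitS; rewrite leqNgt => /negP[]; apply: leq_ltn_trans lt_n.
  apply: leq_trans szS _; rewrite geq_max leq_maxl leq_max; apply/orP; right.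
  by apply: leq_sub2r; apply: (@leq_bigmax_cond _ (clique e) (fun S : {set T} => #|S|)).
have cl0 : clique e set0 by apply/forall_inP => x; rewrite inE.
have [K mK _] := maxset_exists cl0; have [z zK attK] := all_attract K mK.
exact: (no_attracting_clique e_sym e_irr h2c hch all_attract mK zK attK).
Qed.
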